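(* For all integers $n \geq m \geq 4$, $$\sigma(K_m - C_4, n) \geq (2m-6)n-(m-3)(m-2)+2.$$
   Context: All graphs are finite and simple. A sequence $S=(d_1,\dots,d_n)$ of non-negative integers is called graphical if there is a simple graph $G$ of order $n$ whose degree sequence $(d(v_1),\dots,d(v_n))$ is precisely $S$; such a $G$ is called a realization of $S$. Write $\sigma(S)=d_1+d_2+\cdots+d_n$. For a graph $H$, a graphical sequence $S$ is potentially $H$-graphical if there is a realization of $S$ containing $H$ as a subgraph (not necessarily induced). The number $\sigma(H,n)$ denotes the minimum even integer $l$ such that every $n$-term graphical sequence $S$ with $\sigma(S)\geq l$ is potentially $H$-graphical. $K_m$ is the complete graph on $m$ vertices, $C_4$ is the cycle on $4$ vertices, and, for $m \geq 4$, $K_m-C_4$ is the graph (on $m$ vertices) obtained from $K_m$ by removing the four edges of a $4$-cycle $C_4$. *)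

(* Defs.v *)
(* boolp only turns a Prop into a bool, as ex_minn requires. *)
From HB Require Import structures.
From mathcomp Require Import all_boot all_order all_algebra.
From mathcomp Require Import boolp.

Set Implicit Arguments.
Unset Strict Implicit.
Unset Printing Implicit Defensive.

Record sgraph (V : finType) := SGraph {
  adj : rel V;
  adj_sym : symmetric adj;
  adj_irr : irreflexive adj
}.

Definition degree (V : finType) (G : sgraph V) (v : V) : nat :=
  #|[set w | adj G v w]|.

(* Not necessarily induced: only edges are preserved. *)
Definition contains (U V : finType) (H : sgraph U) (G : sgraph V) : Prop :=
  exists2 f : U -> V, injective f & forall x y, adj H x y -> adj G (f x) (f y).

(* The vertices of a graph of order n, listed as v_1, ..., v_n, are the
   elements of 'I_n; terms of a sequence are not required to be sorted. *)
Definition realizes n (G : sgraph 'I_n) (S : n.-tuple nat) : Prop :=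
  forall i, degree G i = tnth S i.

Definition graphical n (S : n.-tuple nat) : Prop :=
  exists G : sgraph 'I_n, realizes G S.

Definition potentially (U : finType) (H : sgraph U) n (S : n.-tuple nat) :
    Prop :=
  exists2 G : sgraph 'I_n, realizes G S & contains H G.

Definition sigma_bound (U : finType) (H : sgraph U) (n l : nat) : Prop :=
  ~~ odd l /\
  forall S : n.-tuple nat, graphical S -> l <= sumn S -> potentially H S.

(* Degrees in a graph of order n are at most n, so l = 2(n^2 + 1) is vacuously
   a bound. *)
Lemma sigma_bound_ex (U : finType) (H : sgraph U) (n : nat) :
  exists l, `[< sigma_bound H n l >].
Proof.
exists (n * n).+1.*2; apply/asboolP; split; first by rewrite odd_double.
move=> S [G GS] leS; suff: sumn S <= n * n.
  move=> /(leq_trans leS); rewrite -addnn addSn ltnNge.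
  by rewrite (leq_trans (leq_addr (n * n).+1 (n * n))).
rewrite sumnE big_tuple.
apply: (@leq_trans (\sum_(i < n) n)); last by rewrite sum_nat_const card_ord.
apply: leq_sum => i _; rewrite -GS /degree.
by rewrite (leq_trans (max_card _)) ?card_ord.
Qed.

Definition sigma (U : finType) (H : sgraph U) (n : nat) : nat :=
  ex_minn (sigma_bound_ex H n).

(* Edges of the cycle 0 - 1 - 2 - 3 - 0. *)
Definition C4_edge (i j : nat) : bool :=
  [&& i < 4, j < 4 & (j == i.+1 %[mod 4]) || (i == j.+1 %[mod 4])].

Definition KC4_adj m : rel 'I_m := fun i j => (i != j) && ~~ C4_edge i j.

Fact KC4_sym m : symmetric (@KC4_adj m).
Proof.
by move=> i j; rewrite /KC4_adj /C4_edge eq_sym andbCA [in LHS]orbC.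
Qed.

Fact KC4_irr m : irreflexive (@KC4_adj m).
Proof. by move=> i; rewrite /KC4_adj eqxx. Qed.

(* K_m - C_4, meaningful for m >= 4: the removed cycle lies on the first four
   vertices, which is no restriction up to isomorphism. *)
Definition K_minus_C4 m : sgraph 'I_m := SGraph (@KC4_sym m) (@KC4_irr m).

(* Main.v *)
(* With k = m - 3, the extremal sequence is the degree sequence of the join of
   K_k and n - k isolated vertices, ((n-1)^k, k^(n-k)).  This join is its only
   realization, since k vertices of full degree already exhaust the degree k of
   the others.  A copy of K_m - C_4 would have at least three vertices outside
   the K_k, hence three pairwise nonadjacent ones; but the complement C_4 is
   triangle-free.  The sum of the sequence, which is even, is two less than the
   claimed bound. *)
Require Import Defs.
From mathcomp Require Import all_boot all_order all_algebra.
From mathcomp Require Import boolp zify.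

Set Implicit Arguments.
Unset Strict Implicit.
Unset Printing Implicit Defensive.

Import Order.TTheory GRing.Theory Num.Theory.
Local Open Scope ring_scope.

Section LowerBound.
Local Open Scope nat_scope.

Lemma card_ord_lt n k : k <= n -> #|[set j : 'I_n | j < k]| = k.
Proof.
move=> le_kn; rewrite -sum1_card.
under eq_bigl do rewrite inE.
by rewrite (big_ord_narrow le_kn) sum_nat_const card_ord muln1.
Qed.

(** A neighbourhood misses its own vertex, so one of size [n.-1] contains every other vertex. *)
Lemma degree_full n (G : sgraph 'I_n) i j :
  degree G i = n.-1 -> i != j -> adj G i j.
Proof.
move=> degi neq_ij.
have sub : [set w | adj G i w] \subset [set~ i].
  by apply/subsetP=> w; rewrite !inE; apply: contraTneq => ->; rewrite adj_irr.
have /setP/(_ j) : [set w | adj G i w] = [set~ i].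
  by apply/eqP; rewrite eqEcard sub cardsC1 card_ord -/(degree G i) degi /=.
by rewrite !inE eq_sym neq_ij.
Qed.

Definition split_adj n k : rel 'I_n :=
  fun i j => (i != j) && ((i < k) || (j < k)).

Fact split_sym n k : symmetric (@split_adj n k).
Proof. by move=> i j; rewrite /split_adj eq_sym orbC. Qed.

Fact split_irr n k : irreflexive (@split_adj n k).
Proof. by move=> i; rewrite /split_adj eqxx. Qed.

Definition split_graph n k : sgraph 'I_n :=
  SGraph (@split_sym n k) (@split_irr n k).

Definition split_seq n k : n.-tuple nat :=
  [tuple if i < k then n.-1 else k | i < n].

Lemma split_graph_realizes n k :
  k <= n -> realizes (split_graph n k) (split_seq n k).
Proof.
move=> le_kn i; rewrite tnth_mktuple /degree /= /split_adj.
case: ltnP => [lt_ik | le_ki].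
  rewrite -[in RHS](card_ord n) -(cardsC1 i); congr #|pred_of_set _|.
  by apply/setP=> j; rewrite !inE andbT eq_sym.
rewrite -[RHS](card_ord_lt le_kn); congr #|pred_of_set _|.
apply/setP=> j; rewrite !inE /=.
by case: ltnP => // lt_jk; rewrite ?andbF // andbT neq_ltn (leq_trans lt_jk) ?orbT.
Qed.

Lemma sumn_split_seq n k :
  k <= n -> sumn (split_seq n k) = k * n.-1 + (n - k) * k.
Proof.
move=> le_kn; rewrite sumnE big_tuple.
under eq_bigr do rewrite tnth_mktuple.
rewrite (bigID (fun i : 'I_n => i < k)) /=; congr (_ + _).
  under eq_bigr => i -> do [].
  by rewrite sum_nat_const -[X in _ = X * _](card_ord_lt le_kn) cardsE.
under eq_bigr => i /negbTE-> do [].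
have <- : #|~: [set j : 'I_n | j < k]| = n - k.
  by rewrite cardsCs setCK card_ord card_ord_lt.
rewrite sum_nat_const.
by congr (_ * _); apply: eq_card => i; rewrite !inE.
Qed.

(** Uniqueness of the realization is used only in this form: the neighbourhood of [i] contains the
    [k] vertices of full degree, and equality follows by cardinality. *)
Lemma split_seq_adj n k (G : sgraph 'I_n) (i j : 'I_n) : k <= n ->
  realizes G (split_seq n k) -> k <= i -> adj G i j = (j < k).
Proof.
move=> le_kn GS le_ki.
have sub : [set w : 'I_n | w < k] \subset [set w | adj G i w].
  apply/subsetP=> w; rewrite !inE => lt_wk; rewrite adj_sym.
  apply: degree_full; first by rewrite GS tnth_mktuple lt_wk.
  by rewrite neq_ltn (leq_trans lt_wk).
have /setP/(_ j) : [set w : 'I_n | w < k] = [set w | adj G i w].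
  apply/eqP; rewrite eqEcard sub card_ord_lt // -/(degree G i).
  by rewrite GS tnth_mktuple ltnNge le_ki /=.
by rewrite !inE => ->.
Qed.

(** Finite check: each index is 0, 1, 2, 3 or at least 4, and the last case is never on an edge. *)
Lemma C4_triangle_free a b c :
  C4_edge a b -> C4_edge b c -> C4_edge c a -> False.
Proof. by case: a b c => [|[|[|[|a]]]] [|[|[|[|b]]]] [|[|[|[|c]]]]. Qed.

Lemma split_seq_not_potentially n k :
  k <= n -> ~ potentially (K_minus_C4 k.+3) (split_seq n k).
Proof.
move=> le_kn [G GS [f inj_f f_adj]].
pose A := [set x | f x < k].
have leA : #|A| <= k.
  rewrite -(card_imset _ inj_f) -[X in _ <= X](card_ord_lt le_kn).
  apply/subset_leq_card/subsetP => _ /imsetP[x + ->].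
  by rewrite !inE.
have /card_gt2P[x [y [z [[xA yA zA] [xy yz zx]]]]] : 2 < #|~: A|.
  by rewrite cardsCs setCK card_ord; lia.
(* If [u] and [v] were adjacent in [K_minus_C4 k.+3], so would be their images in [G], and
   [split_seq_adj] would put [f v] below [k]. *)
have C4E u v : u \in ~: A -> v \in ~: A -> u != v -> C4_edge u v.
  rewrite !inE -!leqNgt => uA vA uv; apply: contraLR vA => nC4; rewrite -ltnNge.
  by rewrite -(split_seq_adj _ le_kn GS uA) f_adj //= /KC4_adj uv.
exact: (C4_triangle_free (C4E _ _ xA yA xy) (C4E _ _ yA zA yz) (C4E _ _ zA xA zx)).
Qed.

(** The minimum [sigma H n] is itself a valid bound, so a graphical counterexample has a smaller
    sum. *)
Lemma sigma_gt (U : finType) (H : sgraph U) n (S : n.-tuple nat) :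
  graphical S -> ~ potentially H S -> sumn S < sigma H n.
Proof.
move=> gS npS; rewrite /sigma; case: ex_minnP => l /asboolP[_ bnd] _.
by rewrite ltnNge; apply/negP => /(bnd _ gS).
Qed.

Lemma sigma_even (U : finType) (H : sgraph U) n : ~~ odd (sigma H n).
Proof. by rewrite /sigma; case: ex_minnP => l /asboolP[]. Qed.

End LowerBound.

Theorem theorem1 (n m : nat) (hm : (4 <= m)%N) (hn : (m <= n)%N) :
  (2%:Z * m%:Z - 6%:Z) * n%:Z - (m%:Z - 3%:Z) * (m%:Z - 2%:Z) + 2%:Z
    <= (sigma (K_minus_C4 m) n)%:Z.
Proof.
case: m hm hn => [|[|[|k]]] // hk hn.
have le_kn : (k <= n)%N by lia.
have gS : graphical (split_seq n k).
  by exists (split_graph n k); apply: split_graph_realizes.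
have := sigma_gt gS (split_seq_not_potentially le_kn).
have := sigma_even (K_minus_C4 k.+3) n.
rewrite sumn_split_seq //; move: (sigma _ _) => s.
(* This form of [n] removes the truncated [n.-1] and [n - k]. *)
have [d ->] : exists d, n = (k + d.+1)%N by exists (n - k.+1)%N; lia.
rewrite addnS /= subSn ?leq_addr // addKn => s_even lt_s.
have k_even : ~~ odd (k * k.+1) by rewrite oddM /= andbN.
have e : (k * (k + d) + d.+1 * k = (k * d).*2 + k * k.+1)%N by lia.
(* Both sides of the strict inequality are even, so the gap is at least 2. *)
have : (((k * d).*2 + k * k.+1).+2 <= s)%N by lia.
(* The claimed bound is exactly the sum plus 2, a polynomial identity in [k] and [d]. *)
rewrite -lez_nat; apply: le_trans; rewrite le_eqVlt; apply/orP; left; apply/eqP.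
lia.
Qed.
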